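(* There are universal constants $c,C>0$ such that the following holds. Let $\rho(L_\star)\le\gamma<1$, and let $\varepsilon$ be such that $\|\widehat A-A_\star\|$, $\|\widehat B-B_\star\|$ and $\|\widehat Q-Q_\star\|$ are at most $\varepsilon$. Assume that $R\succ0$, $(A_\star,B_\star)$ is stabilizable, $(Q_\star^{1/2},A_\star)$ is observable, and $\underline\sigma(P_\star)\ge1$. Then $$\|\widehat P-P_\star\|\le C\,\varepsilon\,\frac{\tau(L_\star,\gamma)^2}{1-\gamma^2}\,\|A_\star\|_+^2\,\|P_\star\|_+^2\,\|B_\star\|_+\,\|R^{-1}\|_+,$$ as long as $$\varepsilon\le c\,\frac{(1-\gamma^2)^2}{\tau(L_\star,\gamma)^4}\,\|A_\star\|_+^{-2}\|P_\star\|_+^{-2}\|B_\star\|_+^{-3}\|R^{-1}\|_+^{-2}\min\big\{\|L_\star\|_+^{-2},\|P_\star\|_+^{-1}\big\}.$$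
   Context: $\|\cdot\|$ is the spectral norm, $\|\cdot\|_+:=\|\cdot\|+1$, $\underline\sigma(\cdot)$ is the smallest singular value, $\rho(\cdot)$ is the spectral radius, and $\tau(M,\rho):=\sup\{\|M^k\|\rho^{-k}:k\ge0\}\in[1,\infty]$. Here $A_\star,\widehat A\in\mathbb R^{n\times n}$, $B_\star,\widehat B\in\mathbb R^{n\times d}$, $Q_\star,\widehat Q\in\mathbb R^{n\times n}$ are symmetric positive semidefinite and $R\in\mathbb R^{d\times d}$ is symmetric. $P_\star$ and $\widehat P$ are the positive semidefinite solutions $P$ of the discrete Riccati equation $P=A^\top PA-A^\top PB(R+B^\top PB)^{-1}B^\top PA+Q$ for $(A,B,Q)=(A_\star,B_\star,Q_\star)$ and $(A,B,Q)=(\widehat A,\widehat B,\widehat Q)$, respectively (the same $R$ in both). $K_\star=-(R+B_\star^\top P_\star B_\star)^{-1}B_\star^\top P_\star A_\star$ and $L_\star=A_\star+B_\star K_\star$. ''Universal constant'' means independent of all dimensions and problem data. *)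

(* Defs.v *)
From HB Require Import structures.
From mathcomp Require Import all_boot all_order all_algebra.
From mathcomp Require Import complex.
From mathcomp Require Import all_classical all_reals ereal.

Set Implicit Arguments.
Unset Strict Implicit.
Unset Printing Implicit Defensive.

Import Order.TTheory GRing.Theory Num.Theory.

Local Open Scope classical_set_scope.
Local Open Scope ring_scope.

Definition l2norm (R : realType) (n : nat) (x : 'cV[R]_n) : R :=
  Num.sqrt (\sum_(i < n) x i ord0 ^+ 2).

Definition spnorm (R : realType) (m n : nat) (M : 'M[R]_(m, n)) : R :=
  sup [set l2norm (M *m x) | x in [set x : 'cV[R]_n | l2norm x <= 1]].

Definition spnormp (R : realType) (m n : nat) (M : 'M[R]_(m, n)) : R :=
  spnorm M + 1.

(* The singular values of a square matrix M are the square roots of the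
   eigenvalues of M^T M.  For n = 0 the set is empty and this is 0. *)
Definition sigma_min (R : realType) (n : nat) (M : 'M[R]_n) : R :=
  inf [set Num.sqrt a | a in [set a : R | eigenvalue (M^T *m M) a]].

(* The moduli range over the complex eigenvalues of the real matrix M. *)
Definition spectral_radius (R : realType) (n : nat) (M : 'M[R]_n) : R :=
  sup [set Normc.normc z
      | z in [set z : R[i] | eigenvalue (map_mx (real_complex R) M) z]].

(* The quotients are taken in \bar R, where a / 0 = +oo for a > 0 and 0 / 0 = 0:
   for r >= 0, r = 0 included, tau M r is the least t such that
   |M^k| <= t * r^k for all k. *)
Definition tau (R : realType) (n : nat) (M : 'M[R]_n) (r : R) : \bar R :=
  ereal_sup (range (fun k : nat => ((spnorm (M ^+ k))%:E / (r ^+ k)%:E)%E)).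

Definition psdmx (R : realType) (n : nat) (M : 'M[R]_n) : Prop :=
  M^T = M /\ forall x : 'cV[R]_n, 0 <= (x^T *m M *m x) ord0 ord0.

Definition pdmx (R : realType) (n : nat) (M : 'M[R]_n) : Prop :=
  M^T = M /\
  forall x : 'cV[R]_n, x != 0 -> 0 < (x^T *m M *m x) ord0 ord0.

Definition is_psd_sqrt (R : realType) (n : nat) (Q S : 'M[R]_n) : Prop :=
  psdmx S /\ S *m S = Q.

Definition stabilizable (R : realType) (n d : nat)
    (A : 'M[R]_n) (B : 'M[R]_(n, d)) : Prop :=
  exists K : 'M[R]_(d, n), spectral_radius (A + B *m K) < 1.

Definition observability_mx (R : realType) (p n : nat)
    (C : 'M[R]_(p, n)) (A : 'M[R]_n) :=
  \mxcol_(k < n) (C *m A ^+ k).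

Definition observable (R : realType) (p n : nat)
    (C : 'M[R]_(p, n)) (A : 'M[R]_n) : Prop :=
  \rank (observability_mx C A) = n.

(* When Rc is positive definite and P positive semidefinite, Rc + B^T P B is
   invertible, so invmx is a genuine inverse here and in dare_gain. *)
Definition dare_eq (R : realType) (n d : nat) (A : 'M[R]_n) (B : 'M[R]_(n, d))
    (Q : 'M[R]_n) (Rc : 'M[R]_d) (P : 'M[R]_n) : Prop :=
  P = A^T *m P *m A
      - A^T *m P *m B *m invmx (Rc + B^T *m P *m B) *m B^T *m P *m A
      + Q.

Definition psd_dare_sol (R : realType) (n d : nat) (A : 'M[R]_n)
    (B : 'M[R]_(n, d)) (Q : 'M[R]_n) (Rc : 'M[R]_d) (P : 'M[R]_n) : Prop :=
  psdmx P /\ dare_eq A B Q Rc P.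

Definition dare_gain (R : realType) (n d : nat) (A : 'M[R]_n)
    (B : 'M[R]_(n, d)) (Rc : 'M[R]_d) (P : 'M[R]_n) : 'M[R]_(d, n) :=
  - (invmx (Rc + B^T *m P *m B) *m B^T *m P *m A).

Definition closed_loop (R : realType) (n d : nat) (A : 'M[R]_n)
    (B : 'M[R]_(n, d)) (Rc : 'M[R]_d) (P : 'M[R]_n) : 'M[R]_n :=
  A + B *m dare_gain A B Rc P.

(* Main.v *)
(* Write S = B R^-1 B^T, so that the Riccati equation reads
   P = A^T P (1 + S P)^-1 A + Q and the closed loop is L = (1 + S P)^-1 A.
   Around P the Riccati map is X |-> L^T X L up to a quadratic remainder of norm
   at most |L|^2 |S| |X|^2, and the bound |L^k| <= tau gamma^k makes
   X |-> X - L^T X L invertible with inverse of norm at most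
   theta = tau^2 / (1 - gamma^2).  The perturbed equation for P + X is thus a
   fixed point equation X = Phi(X), and Phi is a 1/2-contraction of the ball of
   symmetric matrices of norm at most nu = O(theta eps |A|^2 |P|^2 |B| |R^-1|).
   All estimates rest on |N (1 + S N)^-1| <= |N| for positive semidefinite S, N;
   P >= 1 keeps P + X positive semidefinite on the ball and bounds
   (1 + S (P + X))^-1. *)
Require Import Defs.
From HB Require Import structures.
From mathcomp Require Import all_boot all_order all_algebra.
From mathcomp Require Import complex.
From mathcomp Require Import all_classical all_reals ereal.
From mathcomp Require Import ring lra.

Import Order.TTheory GRing.Theory Num.Theory.
Local Open Scope classical_set_scope.
Local Open Scope ring_scope.

Set Implicit Arguments.
Unset Strict Implicit.
Unset Printing Implicit Defensive.

(** * Euclidean inner product, Euclidean norm and Cauchy-Schwarz *)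

Definition dot {R : realType} {n : nat} (x y : 'cV[R]_n) : R :=
  (x^T *m y) ord0 ord0.

Lemma dotC (R : realType) (n : nat) (x y : 'cV[R]_n) : dot x y = dot y x.
Proof.
rewrite /dot -[in LHS](trmxK y) -trmx_mul mxE //.
Qed.

Lemma dotDr (R : realType) (n : nat) (x y z : 'cV[R]_n) :
  dot x (y + z) = dot x y + dot x z.
Proof. by rewrite /dot mulmxDr mxE. Qed.

Lemma dotDl (R : realType) (n : nat) (x y z : 'cV[R]_n) :
  dot (y + z) x = dot y x + dot z x.
Proof. by rewrite dotC dotDr ![dot x _]dotC. Qed.

Lemma dotZr (R : realType) (n : nat) (a : R) (x y : 'cV[R]_n) :
  dot x (a *: y) = a * dot x y.
Proof. by rewrite /dot -scalemxAr mxE. Qed.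

Lemma dotZl (R : realType) (n : nat) (a : R) (x y : 'cV[R]_n) :
  dot (a *: x) y = a * dot x y.
Proof. by rewrite dotC dotZr dotC. Qed.

Lemma dot_mulmxl (R : realType) (m n : nat) (M : 'M[R]_(m, n)) x y :
  dot (M *m x) y = dot x (M^T *m y).
Proof. by rewrite /dot trmx_mul mulmxA. Qed.

Lemma dot_quad (R : realType) (n : nat) (M : 'M[R]_n) (x : 'cV[R]_n) :
  (x^T *m M *m x) ord0 ord0 = dot x (M *m x).
Proof. by rewrite /dot mulmxA. Qed.

Lemma dotxx (R : realType) (n : nat) (x : 'cV[R]_n) :
  dot x x = \sum_i x i ord0 ^+ 2.
Proof. by rewrite /dot mxE; apply: eq_bigr => i _; rewrite mxE expr2. Qed.

Lemma dot_ge0 (R : realType) (n : nat) (x : 'cV[R]_n) : 0 <= dot x x.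
Proof. by rewrite dotxx sumr_ge0 // => i _; exact: sqr_ge0. Qed.

Lemma dot0_eq0 (R : realType) (n : nat) (x : 'cV[R]_n) :
  dot x x <= 0 -> x = 0.
Proof.
move=> x0; have /eqP : dot x x = 0 by apply/le_anti; rewrite x0 dot_ge0.
rewrite dotxx psumr_eq0 => [/allP h|i _]; last exact: sqr_ge0.
apply/colP => i; rewrite mxE.
by have := h i (mem_index_enum _); rewrite sqrf_eq0 => /eqP.
Qed.

Lemma l2norm_ge0 (R : realType) (n : nat) (x : 'cV[R]_n) : 0 <= l2norm x.
Proof. exact: sqrtr_ge0. Qed.

Lemma sqr_l2norm (R : realType) (n : nat) (x : 'cV[R]_n) :
  l2norm x ^+ 2 = dot x x.
Proof. by rewrite /l2norm sqr_sqrtr -dotxx // dot_ge0. Qed.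

Lemma l2norm0 (R : realType) (n : nat) : l2norm (0 : 'cV[R]_n) = 0.
Proof.
by rewrite /l2norm big1 ?sqrtr0 // => i _; rewrite mxE expr0n.
Qed.

Lemma l2norm_le0 (R : realType) (n : nat) (x : 'cV[R]_n) :
  l2norm x <= 0 -> x = 0.
Proof.
move=> x0; have e : l2norm x = 0 by apply/le_anti; rewrite x0 l2norm_ge0.
by apply: dot0_eq0; rewrite -sqr_l2norm e expr0n.
Qed.

Lemma l2normZ (R : realType) (n : nat) (a : R) (x : 'cV[R]_n) :
  l2norm (a *: x) = `|a| * l2norm x.
Proof.
rewrite /l2norm -[`|a|]sqrtr_sqr -sqrtrM ?sqr_ge0 // mulr_sumr.
by congr Num.sqrt; apply: eq_bigr => i _; rewrite mxE exprMn.
Qed.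

Lemma l2norm_le (R : realType) (n : nat) (x : 'cV[R]_n) (a : R) :
  0 <= a -> dot x x <= a ^+ 2 -> l2norm x <= a.
Proof.
by move=> a0 h; rewrite -(ler_pXn2r (n := 2)) // ?nnegrE ?l2norm_ge0 // sqr_l2norm.
Qed.

(** The form of [M] at [x + t y] is a nonnegative quadratic polynomial [a + 2 t b + t^2 c]. Its
    value at [t = - b / c] gives the claim; if [c = 0] and [b] were nonzero, [t = - (a + 1) / (2 b)]
    would give the value -1. *)
Lemma psd_cauchy_schwarz (R : realType) (n : nat) (M : 'M[R]_n)
    (x y : 'cV[R]_n) :
  psdmx M -> dot x (M *m y) ^+ 2 <= dot x (M *m x) * dot y (M *m y).
Proof.
move=> [sM pM].
have pos z : 0 <= dot z (M *m z) by rewrite -dot_quad.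
have e : dot y (M *m x) = dot x (M *m y) by rewrite dotC dot_mulmxl sM.
have q t : 0 <= dot x (M *m x) + 2 * t * dot x (M *m y) + t ^+ 2 * dot y (M *m y).
  have := pos (x + t *: y).
  rewrite mulmxDr -scalemxAr !(dotDl, dotDr, dotZl, dotZr) e.
  by lra.
move: (pos x) (pos y) q => px py q.
set a := dot x (M *m x) in px q *; set b := dot x (M *m y) in q *.
set c := dot y (M *m y) in py q *.
have [c0|c0] := ltP 0 c.
  have := q (- b / c); rewrite -(ler_pM2r c0) mul0r => h.
  have : (a + 2 * (- b / c) * b + (- b / c) ^+ 2 * c) * c = a * c - b ^+ 2.
    by field; rewrite gt_eqF.
  by move=> e2; move: h; rewrite e2 subr_ge0.
have {}c0 : c = 0 by apply/le_anti; rewrite c0.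
rewrite c0 mulr0; have [->|b0] := eqVneq b 0; first by rewrite expr0n.
have := q (- (a + 1) / (2 * b)); rewrite c0 mulr0 addr0.
have -> : a + 2 * (- (a + 1) / (2 * b)) * b = -1 by field.
by rewrite ler0N1.
Qed.

Lemma psdmx1 (R : realType) (n : nat) : psdmx (1%:M : 'M[R]_n).
Proof.
by split=> [|x]; [exact: trmx1 | rewrite dot_quad mul1mx dot_ge0].
Qed.

Lemma dot_le (R : realType) (n : nat) (x y : 'cV[R]_n) :
  dot x y <= l2norm x * l2norm y.
Proof.
have := psd_cauchy_schwarz x y (psdmx1 R n); rewrite !mul1mx => h.
apply: (le_trans (ler_norm _)).
rewrite -(ler_pXn2r (n := 2)) // ?nnegrE ?mulr_ge0 ?l2norm_ge0 //.
by rewrite -normrX ger0_norm ?sqr_ge0 // exprMn !sqr_l2norm.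
Qed.

Lemma l2normD (R : realType) (n : nat) (x y : 'cV[R]_n) :
  l2norm (x + y) <= l2norm x + l2norm y.
Proof.
apply: l2norm_le; first by rewrite addr_ge0 ?l2norm_ge0.
rewrite sqrrD !sqr_l2norm !(dotDl, dotDr) (dotC y x).
by have := dot_le x y; lra.
Qed.

Lemma entry_le_l2norm (R : realType) (n : nat) (x : 'cV[R]_n) i :
  `|x i ord0| <= l2norm x.
Proof.
rewrite -sqrtr_sqr /l2norm ler_wsqrtr // (bigD1 i) //= lerDl.
by rewrite sumr_ge0 // => j _; exact: sqr_ge0.
Qed.

Lemma l2norm_le_sum (R : realType) (n : nat) (x : 'cV[R]_n) :
  l2norm x <= \sum_i `|x i ord0|.
Proof.
apply: l2norm_le; first by rewrite sumr_ge0.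
rewrite dotxx expr2 mulr_suml ler_sum // => i _.
rewrite -[_ ^+ 2]ger0_norm ?sqr_ge0 // normrX expr2 ler_wpM2l //.
by rewrite (bigD1 i) //= lerDl sumr_ge0.
Qed.

(** * The spectral norm *)

(** A crude upper bound for the spectral norm: it shows that the supremum in [spnorm] is finite, and
    it later turns entrywise convergence into convergence in norm. *)
Definition entry_sum {R : realType} {m n : nat} (M : 'M[R]_(m, n)) : R :=
  \sum_i \sum_j `|M i j|.

Lemma l2norm_mulmx_entry (R : realType) (m n : nat) (M : 'M[R]_(m, n)) x :
  l2norm (M *m x) <= entry_sum M * l2norm x.
Proof.
apply: (le_trans (l2norm_le_sum _)); rewrite /entry_sum mulr_suml ler_sum // => i _.
rewrite mxE; apply: (le_trans (ler_norm_sum _ _ _)); rewrite mulr_suml ler_sum // => j _.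
by rewrite normrM ler_wpM2l // entry_le_l2norm.
Qed.

Lemma spnorm_has_sup (R : realType) (m n : nat) (M : 'M[R]_(m, n)) :
  has_sup [set l2norm (M *m x) | x in [set x : 'cV[R]_n | l2norm x <= 1]].
Proof.
split; first by exists (l2norm (M *m 0)), 0 => //=; rewrite l2norm0.
exists (entry_sum M) => _ [x /= x1 <-]; apply: (le_trans (l2norm_mulmx_entry _ _)).
by rewrite ler_piMr // /entry_sum sumr_ge0 // => i _; rewrite sumr_ge0.
Qed.

Lemma spnorm_ge0 (R : realType) (m n : nat) (M : 'M[R]_(m, n)) : 0 <= spnorm M.
Proof.
apply: (le_trans (l2norm_ge0 (M *m 0))).
by apply: ub_le_sup; [case: (spnorm_has_sup M) | exists 0 => //=; rewrite l2norm0].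
Qed.

Lemma spnormP (R : realType) (m n : nat) (M : 'M[R]_(m, n)) x :
  l2norm (M *m x) <= spnorm M * l2norm x.
Proof.
have [x0|x0] := leP (l2norm x) 0.
  rewrite (l2norm_le0 x0) mulmx0 !l2norm0 mulr0 //.
have [y -> y1] : exists2 y, x = l2norm x *: y & l2norm y = 1.
  exists ((l2norm x)^-1 *: x).
    by rewrite scalerA divff ?scale1r // gt_eqF.
  by rewrite l2normZ ger0_norm ?invr_ge0 ?l2norm_ge0 // mulVf // gt_eqF.
rewrite -scalemxAr !l2normZ y1 mulr1 mulrC ler_wpM2r //.
apply: ub_le_sup; first by case: (spnorm_has_sup M).
by exists y => //=; rewrite y1.
Qed.

Lemma spnorm_le (R : realType) (m n : nat) (M : 'M[R]_(m, n)) (a : R) :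
  0 <= a -> (forall x, l2norm (M *m x) <= a * l2norm x) -> spnorm M <= a.
Proof.
move=> a0 h; apply: ge_sup => [|_ [x /= x1 <-]]; first by case: (spnorm_has_sup M).
by apply: (le_trans (h x)); rewrite ler_piMr.
Qed.

Lemma spnorm_le_entry (R : realType) (m n : nat) (M : 'M[R]_(m, n)) :
  spnorm M <= entry_sum M.
Proof.
apply: spnorm_le => [|x]; last exact: l2norm_mulmx_entry.
by rewrite /entry_sum sumr_ge0 // => i _; rewrite sumr_ge0.
Qed.

Lemma entry_le_spnorm (R : realType) (m n : nat) (M : 'M[R]_(m, n)) i j :
  `|M i j| <= spnorm M.
Proof.
have -> : M i j = (M *m (delta_mx j 0 : 'cV_n)) i ord0.
  by have /matrixP/(_ i ord0) := colE j M; rewrite mxE.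
apply: (le_trans (entry_le_l2norm _ _)); apply: (le_trans (spnormP _ _)).
rewrite ler_piMr ?spnorm_ge0 //; apply: l2norm_le => //.
rewrite dotxx (bigD1 j) //= big1 => [|k kj]; rewrite !mxE ?eqxx ?(negbTE kj) ?expr0n //=.
by rewrite addr0.
Qed.

Lemma spnorm0 (R : realType) (m n : nat) : spnorm (0 : 'M[R]_(m, n)) = 0.
Proof.
apply/le_anti; rewrite spnorm_ge0 andbT; apply: spnorm_le => // x.
by rewrite mul0mx l2norm0 mul0r.
Qed.

Lemma spnorm_le0 (R : realType) (m n : nat) (M : 'M[R]_(m, n)) :
  spnorm M <= 0 -> M = 0.
Proof.
move=> h; apply/matrixP => i j; rewrite mxE; apply/eqP.
by rewrite -normr_le0 (le_trans (entry_le_spnorm M i j)).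
Qed.

Lemma spnorm_leD (R : realType) (m n : nat) (M N : 'M[R]_(m, n)) (a b : R) :
  spnorm M <= a -> spnorm N <= b -> spnorm (M + N) <= a + b.
Proof.
move=> Ma Nb; apply: spnorm_le => [|x].
  by rewrite addr_ge0 ?(le_trans (spnorm_ge0 _) Ma) ?(le_trans (spnorm_ge0 _) Nb).
rewrite mulmxDl (le_trans (l2normD _ _)) // mulrDl lerD // (le_trans (spnormP _ _)) //.
  by rewrite ler_wpM2r ?l2norm_ge0.
by rewrite ler_wpM2r ?l2norm_ge0.
Qed.

Lemma spnormN (R : realType) (m n : nat) (M : 'M[R]_(m, n)) :
  spnorm (- M) = spnorm M.
Proof.
suff h (N : 'M[R]_(m, n)) : spnorm (- N) <= spnorm N.
  by apply/le_anti; rewrite h -{1}[M]opprK h.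
apply: spnorm_le => [|x]; first exact: spnorm_ge0.
by rewrite mulNmx -scaleN1r l2normZ normrN1 mul1r spnormP.
Qed.

Lemma spnorm_leB (R : realType) (m n : nat) (M N : 'M[R]_(m, n)) (a b : R) :
  spnorm M <= a -> spnorm N <= b -> spnorm (M - N) <= a + b.
Proof. by move=> Ma Nb; apply: spnorm_leD => //; rewrite spnormN. Qed.

Lemma spnorm_leM (R : realType) (m n p : nat) (M : 'M[R]_(m, n))
    (N : 'M[R]_(n, p)) (a b : R) :
  spnorm M <= a -> spnorm N <= b -> spnorm (M *m N) <= a * b.
Proof.
move=> Ma Nb.
have a0 := le_trans (spnorm_ge0 M) Ma; have b0 := le_trans (spnorm_ge0 N) Nb.
apply: spnorm_le => [|x]; first exact: mulr_ge0.
rewrite -mulmxA (le_trans (spnormP _ _)) // -mulrA.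
apply: ler_pM; rewrite ?spnorm_ge0 ?l2norm_ge0 //.
by rewrite (le_trans (spnormP _ _)) // ler_wpM2r ?l2norm_ge0.
Qed.

(** From [|N^T x|^2 = <x, N N^T x> <= |x| |N| |N^T x|] one factor [|N^T x|] cancels; the reverse
    inequality is the same one for the transpose. *)
Lemma spnorm_tr (R : realType) (m n : nat) (M : 'M[R]_(m, n)) :
  spnorm M^T = spnorm M.
Proof.
suff h (k l : nat) (N : 'M[R]_(k, l)) : spnorm N^T <= spnorm N.
  by apply/le_anti; rewrite h -{1}[M]trmxK h.
apply: spnorm_le => [|x]; first exact: spnorm_ge0.
have [y0|y0] := leP (l2norm (N^T *m x)) 0.
  by rewrite (le_trans y0) ?mulr_ge0 ?l2norm_ge0 ?spnorm_ge0.
rewrite -(ler_pM2r y0) -expr2 sqr_l2norm dot_mulmxl trmxK.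
rewrite (le_trans (dot_le _ _)) // [leRHS]mulrAC mulrC ler_wpM2r ?l2norm_ge0 //.
exact: spnormP.
Qed.

(** The size is a successor because the identity of size 0 has norm 0. *)
Lemma spnorm1 (R : realType) (n : nat) : spnorm (1%:M : 'M[R]_n.+1) = 1.
Proof.
apply/le_anti/andP; split.
  by apply: spnorm_le => // x; rewrite mul1mx mul1r.
by have := entry_le_spnorm (1%:M : 'M[R]_n.+1) 0 0; rewrite mxE eqxx normr1.
Qed.

(** * Geometric decay and a criterion for invertibility *)

(** Stands in for letting [k] tend to infinity. Bernoulli's inequality gives
    [q^k (1 + k (1 - q)) <= 1], so a positive [x] would bound every [k] by [a / (x (1 - q))],
    against the Archimedean property. *)
Lemma geometric_le0 (R : realType) (q a x : R) :
  0 <= q -> q < 1 -> (forall k : nat, x <= a * q ^+ k) -> x <= 0.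
Proof.
move=> q0 q1 h.
have bern k : q ^+ k * (1 + k%:R * (1 - q)) <= 1.
  elim: k => [|k IH]; first by rewrite expr0 mul0r addr0 mul1r.
  apply: le_trans IH; rewrite exprSr -mulrA ler_wpM2l ?exprn_ge0 //.
  rewrite -(@natr1 _ k).
  have := ler0n R k; set t := k%:R => t0.
  have : 0 <= t * (1 - q) ^+ 2 by rewrite mulr_ge0 ?sqr_ge0.
  have : 0 <= (1 - q) ^+ 2 by rewrite sqr_ge0.
  nra.
rewrite leNgt; apply/negP => x0.
have a0 : 0 < a by rewrite (lt_le_trans x0) // (le_trans (h 0)) // expr0 mulr1.
have k_le (k : nat) : k%:R <= a / (x * (1 - q)).
  rewrite ler_pdivlMr ?mulr_gt0 ?subr_gt0 //.
  have := h k; have := bern k; have := ler0n R k; have := exprn_ge0 k q0.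
  set t := q ^+ k; set s : R := k%:R => t0 s0 ts xt.
  have : 0 <= 1 - q by lra.
  move=> q2; have := ler_wpM2r (mulr_ge0 s0 q2) xt; have := ler_wpM2l (ltW a0) ts.
  by have := mulr_ge0 (ltW a0) t0; lra.
have := archi_boundP (ltW (divr_gt0 a0 (mulr_gt0 x0 (_ : 0 < 1 - q)))).
by rewrite subr_gt0 => /(_ q1); rewrite ltNge k_le.
Qed.

Lemma unitmx_inj (R : realType) (n : nat) (M : 'M[R]_n) :
  (forall x : 'cV[R]_n, M *m x = 0 -> x = 0) -> M \in unitmx.
Proof.
move=> inj; rewrite -unitmx_tr -row_free_unit -kermx_eq0.
apply/eqP/row_matrixP => i; rewrite row0; apply: trmx_inj; rewrite trmx0.
apply: inj; apply: trmx_inj; rewrite trmx_mul trmxK trmx0.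
by rewrite -row_mul mulmx_ker row0.
Qed.

(** * Resolvents of pairs of positive semidefinite matrices *)

(** Cauchy-Schwarz for the form of [N], applied to [N x] and [x], gives
    [|N x|^4 <= <N x, N N x> <x, N x>]; the first factor is at most [|N| |N x|^2]. *)
Lemma psd_sqr_mulmx_le (R : realType) (n : nat) (N : 'M[R]_n) x :
  psdmx N -> l2norm (N *m x) ^+ 2 <= spnorm N * dot x (N *m x).
Proof.
move=> hN; have := psd_cauchy_schwarz (N *m x) x hN; have [sN pN] := hN.
have : 0 <= dot x (N *m x) by rewrite -dot_quad.
move: (N *m x) => v; rewrite -sqr_l2norm => x0.
have : dot v (N *m v) <= spnorm N * l2norm v ^+ 2.
  rewrite (le_trans (dot_le _ _)) // expr2 mulrA [leRHS]mulrC.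
  by rewrite ler_wpM2l ?l2norm_ge0 // spnormP.
have [v0 _ _|v0 h1 h2] := leP (l2norm v ^+ 2) 0.
  by rewrite (le_trans v0) // mulr_ge0 // spnorm_ge0.
rewrite -(ler_pM2r v0) -expr2 (le_trans h2) //.
by rewrite [leRHS]mulrAC ler_wpM2r.
Qed.

Definition resolvent {R : realType} {n : nat} (S N : 'M[R]_n) : 'M[R]_n :=
  invmx (1%:M + S *m N).

(* With y = (1 + S N)^-1 x this bounds N (1 + S N)^-1 by the norm of N,
   whatever the size of S. *)
Lemma psd_resolvent_le (R : realType) (n : nat) (S N : 'M[R]_n) y :
  psdmx S -> psdmx N ->
  l2norm (N *m y) <= spnorm N * l2norm ((1%:M + S *m N) *m y).
Proof.
move=> [_ pS] hN; have [v0|v0] := leP (l2norm (N *m y)) 0.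
  by rewrite (le_trans v0) // mulr_ge0 ?spnorm_ge0 ?l2norm_ge0.
rewrite -(ler_pM2r v0) -expr2 (le_trans (psd_sqr_mulmx_le _ hN)) // -mulrA.
rewrite ler_wpM2l ?spnorm_ge0 // (le_trans _ (dot_le _ _)) //.
rewrite mulmxDl mul1mx dotDl lerDl -mulmxA dotC -dot_quad.
exact: pS.
Qed.

(** For [y] in the kernel the preceding bound gives [N y = 0], and then [y = - S N y = 0]. *)
Lemma resolvent_unit (R : realType) (n : nat) (S N : 'M[R]_n) :
  psdmx S -> psdmx N -> 1%:M + S *m N \in unitmx.
Proof.
move=> hS hN; apply: unitmx_inj => y y0.
have := psd_resolvent_le y hS hN; rewrite y0 l2norm0 mulr0 => /l2norm_le0 Ny.
by move: y0; rewrite mulmxDl mul1mx -mulmxA Ny mulmx0 addr0.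
Qed.

Lemma resolvent_push (R : realType) (n : nat) (S N : 'M[R]_n) :
  psdmx S -> psdmx N -> N *m resolvent S N = resolvent N S *m N.
Proof.
move=> hS hN; have u := resolvent_unit hS hN; have u' := resolvent_unit hN hS.
have e : (1%:M + N *m S) *m N = N *m (1%:M + S *m N).
  by rewrite mulmxDl mulmxDr mul1mx mulmx1 mulmxA.
by rewrite -[LHS](mulKmx u') [X in invmx _ *m X]mulmxA e mulmxK.
Qed.

Lemma trmx_resolvent (R : realType) (n : nat) (S N : 'M[R]_n) :
  psdmx S -> psdmx N -> (resolvent S N)^T = resolvent N S.
Proof.
by move=> [sS _] [sN _]; rewrite trmx_inv linearD /= trmx1 trmx_mul sS sN.
Qed.

Lemma spnorm_mul_resolvent (R : realType) (n : nat) (S N : 'M[R]_n) :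
  psdmx S -> psdmx N -> spnorm (N *m resolvent S N) <= spnorm N.
Proof.
move=> hS hN; apply: spnorm_le => [|x]; first exact: spnorm_ge0.
rewrite -mulmxA (le_trans (psd_resolvent_le _ hS hN)) //.
by rewrite mulKVmx ?resolvent_unit.
Qed.

Lemma spnorm_resolvent_mul (R : realType) (n : nat) (S N : 'M[R]_n) :
  psdmx S -> psdmx N -> spnorm (resolvent S N *m S) <= spnorm S.
Proof. by move=> hS hN; rewrite -resolvent_push // spnorm_mul_resolvent. Qed.

(** The coercivity [N >= 1/2] gives [|y| <= 2 |N y|], which turns the bound on [N (1 + S N)^-1] into
    one on the resolvent itself, still independent of [S]. *)
Lemma spnorm_resolvent (R : realType) (n : nat) (S N : 'M[R]_n) :
  psdmx S -> psdmx N -> (forall x, dot x x <= 2 * dot x (N *m x)) ->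
  spnorm (resolvent S N) <= 2 * spnorm N.
Proof.
move=> hS hN cN.
have low y : l2norm y <= 2 * l2norm (N *m y).
  have [y0|y0] := leP (l2norm y) 0.
    by rewrite (le_trans y0) // mulr_ge0 ?l2norm_ge0.
  rewrite -(ler_pM2r y0) -expr2 sqr_l2norm (le_trans (cN y)) // -mulrA.
  by rewrite ler_wpM2l // mulrC dot_le.
apply: spnorm_le => [|x]; first by rewrite mulr_ge0 ?spnorm_ge0.
rewrite (le_trans (low _)) // -mulrA ler_wpM2l //.
by rewrite (le_trans (psd_resolvent_le _ hS hN)) // mulKVmx ?resolvent_unit.
Qed.

Lemma invmxB (R : realType) (n : nat) (U V : 'M[R]_n) :
  U \in unitmx -> V \in unitmx ->
  invmx U - invmx V = invmx U *m (V - U) *m invmx V.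
Proof.
by move=> u v; rewrite mulmxBr mulmxBl mulVmx // mul1mx mulmxK.
Qed.

Lemma resolventB (R : realType) (n : nat) (S1 N1 S2 N2 : 'M[R]_n) :
  psdmx S1 -> psdmx N1 -> psdmx S2 -> psdmx N2 ->
  resolvent S1 N1 - resolvent S2 N2 =
  resolvent S1 N1 *m (S2 *m N2 - S1 *m N1) *m resolvent S2 N2.
Proof.
move=> ? ? ? ?; rewrite /resolvent invmxB ?resolvent_unit //.
by rewrite opprD addrACA subrr add0r.
Qed.

(** In [N1 (1 + S N2) - (1 + N1 S) N2] the products [N1 S N2] cancel. Having one resolvent on each
    side makes the difference of two Riccati maps a product around [N1 - N2]. *)
Lemma mul_resolventB (R : realType) (n : nat) (S N1 N2 : 'M[R]_n) :
  psdmx S -> psdmx N1 -> psdmx N2 ->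
  N1 *m resolvent S N1 - N2 *m resolvent S N2 =
  resolvent N1 S *m (N1 - N2) *m resolvent S N2.
Proof.
move=> hS h1 h2; have u1 := resolvent_unit h1 hS; have u2 := resolvent_unit hS h2.
rewrite resolvent_push //.
have -> : N1 - N2 = N1 *m (1%:M + S *m N2) - (1%:M + N1 *m S) *m N2.
  by rewrite mulmxDr mulmxDl mulmx1 mul1mx mulmxA opprD addrACA subrr addr0.
by rewrite mulmxBr mulmxBl mulmxA mulmxK // mulKmx.
Qed.

(* Conjugating by A turns this into the Riccati map expanded around P: the
   linear part is L^T X L, with L = resolvent S P *m A the closed loop. *)
Lemma mul_resolvent_expand (R : realType) (n : nat) (S P X : 'M[R]_n) :
  psdmx S -> psdmx P -> psdmx (P + X) ->
  (P + X) *m resolvent S (P + X) - P *m resolvent S P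
    - resolvent P S *m X *m resolvent S P
  = - (resolvent P S *m (X *m (resolvent S (P + X) *m S) *m X) *m resolvent S P).
Proof.
move=> hS hP hN.
have -> : (P + X) *m resolvent S (P + X) - P *m resolvent S P
    = resolvent P S *m X *m resolvent S (P + X).
  by rewrite -opprB mul_resolventB // opprD addNKr mulmxN mulNmx opprK.
rewrite -mulmxBr resolventB // [S *m (P + X)]mulmxDr opprD addNKr mulmxN mulNmx mulmxN.
by rewrite !mulmxA.
Qed.

(** Gives the Lipschitz bound for the middle factor of the quadratic remainder. *)
Lemma resolvent_mulB (R : realType) (n : nat) (S N1 N2 : 'M[R]_n) :
  psdmx S -> psdmx N1 -> psdmx N2 ->
  resolvent S N1 *m S - resolvent S N2 *m S =
  resolvent S N1 *m S *m (N2 - N1) *m (resolvent S N2 *m S).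
Proof.
by move=> ? ? ?; rewrite -mulmxBl resolventB // -mulmxBr !mulmxA.
Qed.

(** * Definite matrices, the Riccati equation in resolvent form, and the smallest singular value *)

Lemma psdmx_congr (R : realType) (m n : nat) (M : 'M[R]_n) (B : 'M[R]_(m, n)) :
  psdmx M -> psdmx (B *m M *m B^T).
Proof.
move=> [sM pM]; split=> [|x]; first by rewrite !trmx_mul trmxK sM mulmxA.
by rewrite dot_quad -!mulmxA -{1}[B]trmxK -dot_mulmxl -dot_quad.
Qed.

Lemma pdmx_psd (R : realType) (n : nat) (M : 'M[R]_n) : pdmx M -> psdmx M.
Proof.
move=> [sM pM]; split=> // x; have [->|x0] := eqVneq x 0.
  by rewrite mulmx0 mxE.
exact/ltW/pM.
Qed.

Lemma pdmxD_unit (R : realType) (n : nat) (M N : 'M[R]_n) :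
  pdmx M -> psdmx N -> M + N \in unitmx.
Proof.
move=> [_ pM] [_ pN]; apply: unitmx_inj => x x0; apply/eqP/negP => /negP /pM.
rewrite ltNge => /negP; apply.
have : dot x ((M + N) *m x) = 0 by rewrite x0 -(scale0r 0) dotZr mul0r.
rewrite mulmxDl dotDr -!dot_quad => /eqP; rewrite addr_eq0 => /eqP ->.
by rewrite oppr_le0.
Qed.

Lemma pdmx_unit (R : realType) (n : nat) (M : 'M[R]_n) : pdmx M -> M \in unitmx.
Proof.
move=> hM; rewrite -[M]addr0; apply: pdmxD_unit => //.
by split=> [|x]; [exact: trmx0 | rewrite mulmx0 mul0mx mxE].
Qed.

Lemma psdmx_inv (R : realType) (n : nat) (M : 'M[R]_n) :
  pdmx M -> psdmx (invmx M).
Proof.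
move=> hM; have [sM pM] := pdmx_psd hM; have u := pdmx_unit hM.
split=> [|x]; first by rewrite trmx_inv sM.
rewrite -(mulKVmx u x) dot_quad [invmx M *m (M *m _)]mulKmx //.
by rewrite dotC -dot_quad.
Qed.

Definition gram {R : realType} {n d : nat} (B : 'M[R]_(n, d)) (Rc : 'M[R]_d)
  : 'M[R]_n := B *m invmx Rc *m B^T.

Lemma gram_psd (R : realType) (n d : nat) (B : 'M[R]_(n, d)) (Rc : 'M[R]_d) :
  pdmx Rc -> psdmx (gram B Rc).
Proof. by move=> hR; apply: psdmx_congr; apply: psdmx_inv. Qed.

(* The Woodbury identity. *)
Lemma resolvent_gram (R : realType) (n d : nat) (B : 'M[R]_(n, d))
    (Rc : 'M[R]_d) (P : 'M[R]_n) :
  pdmx Rc -> psdmx P ->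
  resolvent (gram B Rc) P =
  1%:M - B *m invmx (Rc + B^T *m P *m B) *m B^T *m P.
Proof.
move=> hR hP; have u := resolvent_unit (gram_psd B hR) hP.
have uR := pdmx_unit hR.
have uL : Rc + B^T *m P *m B \in unitmx.
  by apply: pdmxD_unit => //; rewrite -{2}[B]trmxK; exact: psdmx_congr.
rewrite -[RHS](mulmxK u) -[LHS]mul1mx; congr (_ *m _).
set La := Rc + _ in uL *.
(* Since [B^T P B = La - Rc], the product collapses to a difference of inverses. *)
have e : invmx La *m B^T *m P *m gram B Rc = (invmx Rc - invmx La) *m B^T.
  have -> : invmx La *m B^T *m P *m gram B Rc
      = invmx La *m (La - Rc) *m invmx Rc *m B^T.
    by rewrite /La /gram addrAC subrr add0r !mulmxA.
  by rewrite mulmxBr mulVmx // !mulmxBl mul1mx -[invmx La *m Rc *m _]mulmxA mulmxV // mulmx1.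
have -> : B *m invmx La *m B^T *m P = B *m (invmx La *m B^T *m P).
  by rewrite !mulmxA.
move: e; set K := invmx La *m B^T *m P => e.
rewrite mulmxBl mul1mx mulmxDr mulmx1 -[B *m K *m _]mulmxA [K *m (_ *m _)]mulmxA e.
rewrite !mulmxBl mulmxBr -/K.
have -> : B *m (invmx Rc *m B^T *m P) = gram B Rc *m P by rewrite !mulmxA.
by rewrite [B *m K + _]addrC subrK addrK.
Qed.

(** By the Woodbury identity the Riccati map depends on [B] and [Rc] only through [gram B Rc]. *)
Lemma riccati_gram (R : realType) (n d : nat) (A : 'M[R]_n)
    (B : 'M[R]_(n, d)) (Rc : 'M[R]_d) (P : 'M[R]_n) :
  pdmx Rc -> psdmx P ->
  A^T *m P *m A - A^T *m P *m B *m invmx (Rc + B^T *m P *m B) *m B^T *m P *m A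
  = A^T *m (P *m resolvent (gram B Rc) P) *m A.
Proof.
move=> hR hP; rewrite resolvent_gram // [P *m (_ - _)]mulmxBr mulmx1.
by rewrite mulmxBr mulmxBl !mulmxA.
Qed.

Lemma closed_loop_gram (R : realType) (n d : nat) (A : 'M[R]_n)
    (B : 'M[R]_(n, d)) (Rc : 'M[R]_d) (P : 'M[R]_n) :
  pdmx Rc -> psdmx P ->
  closed_loop A B Rc P = resolvent (gram B Rc) P *m A.
Proof.
move=> hR hP; rewrite resolvent_gram // mulmxBl mul1mx /closed_loop /dare_gain.
by rewrite mulmxN !mulmxA.
Qed.

(* The infimum mu of the Rayleigh quotient is an eigenvalue: were P - mu%:M
   invertible, it would be bounded below by a positive multiple of the identity. *)
Lemma sigma_min_rayleigh (R : realType) (n : nat) (P : 'M[R]_n) (s : R) :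
  psdmx P -> s <= sigma_min P -> forall x, s * dot x x <= dot x (P *m x).
Proof.
move=> hP sP; have [sym pP] := hP.
have posP x : 0 <= dot x (P *m x) by rewrite -dot_quad.
set T := [set dot x (P *m x) | x in [set x : 'cV[R]_n | dot x x = 1]].
have ray x : inf T * dot x x <= dot x (P *m x).
  have [x0|x0] := leP (dot x x) 0; first by rewrite (dot0_eq0 x0) mulmx0 -(scale0r 0) !dotZl !mul0r mulr0.
  have l0 : 0 < l2norm x by rewrite lt_def l2norm_ge0 andbT -sqrf_eq0 sqr_l2norm gt_eqF.
  have [y xy y1] : exists2 y, x = l2norm x *: y & dot y y = 1.
    exists ((l2norm x)^-1 *: x); first by rewrite scalerA divff ?scale1r // gt_eqF.
    by rewrite dotZl dotZr -sqr_l2norm mulrA -expr2 -exprMn mulVf ?expr1n // gt_eqF.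
  rewrite xy -scalemxAr !(dotZl, dotZr) y1 mulr1 mulrC -mulrA !(ler_wpM2l (ltW l0)) //.
  apply: ge_inf; last by exists y.
  by exists 0 => _ [z _ <-].
move=> x; have [x0|x0] := leP (dot x x) 0.
  by rewrite (dot0_eq0 x0) mulmx0 -(scale0r 0) !dotZl !mul0r mulr0.
apply: le_trans (ray x); rewrite ler_wpM2r ?(ltW x0) // (le_trans sP) //.
have T0 : T !=set0.
  exists (dot ((l2norm x)^-1 *: x) (P *m ((l2norm x)^-1 *: x))).
  exists ((l2norm x)^-1 *: x) => //=.
  rewrite dotZl dotZr -sqr_l2norm mulrA -expr2 -exprMn mulVf ?expr1n //.
  by rewrite -sqrf_eq0 sqr_l2norm gt_eqF.
have mu0 : 0 <= inf T by apply: lb_le_inf => // _ [z _ <-].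
move: ray mu0; set mu := inf T => ray mu0.
pose N : 'M[R]_n := P - mu%:M.
have NE z : N *m z = P *m z - mu *: z by rewrite mulmxBl mul_scalar_mx.
have dN z : dot z (N *m z) = dot z (P *m z) - mu * dot z z.
  by rewrite NE -scaleNr dotDr dotZr mulNr.
have pN : psdmx N.
  split=> [|z]; first by rewrite linearB /= tr_scalar_mx sym.
  by rewrite dot_quad dN subr_ge0.
have nuN : N \notin unitmx.
  (* For a unit vector [z], [1 <= |N^-1|^2 |N z|^2 <= D <z, N z>], so [mu + 1 / D] would be a larger
     lower bound of the Rayleigh quotient. *)
  apply/negP => uN; pose D := spnorm (invmx N) ^+ 2 * spnorm N.
  have low z : dot z z = 1 -> 1 <= D * (dot z (P *m z) - mu).
    move=> z1; have := psd_sqr_mulmx_le z pN; rewrite dN z1 mulr1 => h.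
    have := spnormP (invmx N) (N *m z); rewrite mulKmx // => h2.
    have /le_trans -> // : 1 <= spnorm (invmx N) ^+ 2 * l2norm (N *m z) ^+ 2.
      rewrite -exprMn -z1 -sqr_l2norm ler_pXn2r ?nnegrE ?l2norm_ge0 //.
      by rewrite mulr_ge0 ?spnorm_ge0 ?l2norm_ge0.
    by rewrite /D -mulrA ler_wpM2l // sqr_ge0.
  have D0 : 0 < D.
    case: (T0) => _ [z /= z1 _].
    rewrite lt_def mulr_ge0 ?sqr_ge0 ?spnorm_ge0 // andbT.
    by apply/eqP => e; have := low z z1; rewrite e mul0r ler10.
  have : mu + D^-1 <= inf T.
    apply: lb_le_inf => // _ [z z1 <-].
    by rewrite -lerBrDl -(ler_pM2l D0) divff ?low // gt_eqF.
  by rewrite -/mu gerDl leNgt invr_gt0 D0.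
have [v v0 Nv] : exists2 v : 'cV[R]_n, v != 0 & N *m v = 0.
  apply: contrapT => h; move/negP: nuN; apply; apply: unitmx_inj => z z0.
  by apply: contrapT => /eqP zn; apply: h; exists z.
have Pv : P *m v = mu *: v by apply/eqP; rewrite -subr_eq0 -NE Nv.
apply: ge_inf; first by exists 0 => _ [a _ <-]; exact: sqrtr_ge0.
(* [mu^2] is an eigenvalue of [P^T P] and [mu >= 0], so [mu] is one of the singular values.
   Eigenvectors are rows here, hence [v^T]. *)
exists (mu ^+ 2); last by rewrite sqrtr_sqr ger0_norm.
apply/eigenvalueP; exists v^T; last by rewrite trmx_eq0.
apply: trmx_inj; rewrite !trmx_mul !trmxK sym -mulmxA Pv -scalemxAr Pv.
by rewrite scalerA -expr2 linearZ /= trmxK.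
Qed.

(** * The Stein operator and its inverse *)

Definition stein {R : realType} {n : nat} (L X : 'M[R]_n) : 'M[R]_n :=
  X - L^T *m X *m L.

Lemma steinB (R : realType) (n : nat) (L X Y : 'M[R]_n) :
  stein L (X - Y) = stein L X - stein L Y.
Proof. by rewrite /stein mulmxBr mulmxBl !opprD opprK addrACA. Qed.

(** The difference is the sum over [j < k] of [(L^j)^T (stein L X) L^j], whose terms have norm at
    most [t^2 g^(2j) |stein L X|]; the last factor is the partial geometric sum. *)
Lemma stein_telescope (R : realType) (n : nat) (L X : 'M[R]_n) (t g : R) :
  0 <= t -> 0 <= g -> g < 1 -> (forall k, spnorm (L ^+ k) <= t * g ^+ k) ->
  forall k, spnorm (X - (L ^+ k)^T *m X *m L ^+ k) <=
    t ^+ 2 * spnorm (stein L X) * ((1 - (g ^+ 2) ^+ k) / (1 - g ^+ 2)).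
Proof.
move=> t0 g0 g1 Lk; have g2 : 0 < 1 - g ^+ 2 by rewrite subr_gt0 expr_lt1.
elim=> [|k IH].
  by rewrite !expr0 trmx1 mul1mx mulmx1 !subrr spnorm0 mul0r mulr0.
have -> : X - (L ^+ k.+1)^T *m X *m L ^+ k.+1 =
    (X - (L ^+ k)^T *m X *m L ^+ k) + (L ^+ k)^T *m stein L X *m L ^+ k.
  rewrite exprS -mulmxE trmx_mul /stein mulmxBr mulmxBl !mulmxA addrA subrK //.
have Lt : spnorm (L ^+ k)^T <= t * g ^+ k by rewrite spnorm_tr.
have := spnorm_leD IH (spnorm_leM (spnorm_leM Lt (lexx (spnorm (stein L X)))) (Lk k)).
move/le_trans; apply; rewrite [(g ^+ 2) ^+ k.+1]exprSr.
have -> : (g ^+ 2) ^+ k = (g ^+ k) ^+ 2 by rewrite -!exprM mulnC.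
rewrite le_eqVlt; apply/orP; left; apply/eqP; field.
by rewrite gt_eqF.
Qed.

(** The boundary term [(L^k)^T X L^k] left by the telescoping is at most [t^2 |X| g^(2k)], and
    [geometric_le0] removes it. *)
Lemma spnorm_stein (R : realType) (n : nat) (L X : 'M[R]_n) (t g : R) :
  0 <= t -> 0 <= g -> g < 1 -> (forall k, spnorm (L ^+ k) <= t * g ^+ k) ->
  spnorm X <= t ^+ 2 / (1 - g ^+ 2) * spnorm (stein L X).
Proof.
move=> t0 g0 g1 Lk; have g2 : 0 < 1 - g ^+ 2 by rewrite subr_gt0 expr_lt1.
rewrite -subr_le0; apply: (@geometric_le0 _ (g ^+ 2) (t ^+ 2 * spnorm X)).
- exact: sqr_ge0.
- by rewrite -subr_gt0.
move=> k; have Lt : spnorm (L ^+ k)^T <= t * g ^+ k by rewrite spnorm_tr.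
have := spnorm_leD (stein_telescope X t0 g0 g1 Lk k)
  (spnorm_leM (spnorm_leM Lt (lexx (spnorm X))) (Lk k)).
rewrite subrK => h; rewrite lerBlDl (le_trans h) // lerD //.
  rewrite [leRHS]mulrAC ler_wpM2l ?mulr_ge0 ?sqr_ge0 ?spnorm_ge0 //.
  by rewrite ler_piMl ?invr_ge0 ?(ltW g2) // gerBl exprn_ge0 ?sqr_ge0.
rewrite le_eqVlt; apply/orP; left; apply/eqP.
have -> : (g ^+ 2) ^+ k = (g ^+ k) ^+ 2 by rewrite -!exprM mulnC.
by ring.
Qed.

(** Finite dimension: the matrix of [f] acting on vectorized matrices has trivial kernel, hence is
    invertible. *)
Lemma linear_mx_surj (R : realType) (n : nat) (f : {linear 'M[R]_n -> 'M[R]_n}) :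
  (forall X, f X = 0 -> X = 0) -> forall Y, exists X, f X = Y.
Proof.
move=> inj Y; have u : lin_mx f \in unitmx.
  rewrite -unitmx_tr; apply: unitmx_inj => x x0.
  have : vec_mx x^T = 0.
    apply: inj; apply: (can_inj mxvecK); rewrite linear0 -mul_vec_lin vec_mxK.
    by apply: trmx_inj; rewrite trmx_mul trmxK x0 trmx0.
  move/(congr1 mxvec); rewrite vec_mxK linear0 => /(congr1 trmx).
  by rewrite trmxK trmx0.
exists (vec_mx (mxvec Y *m invmx (lin_mx f))).
by apply: (can_inj mxvecK); rewrite -mul_vec_lin vec_mxK mulmxKV.
Qed.

(** The a priori bound [spnorm_stein] makes the operator injective, hence surjective, and bounds the
    inverse; no series is summed. Symmetry follows from injectivity, as [(T Y)^T] solves the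
    transposed equation. [T] comes from a choice of preimages, so its Lipschitz bound is stated
    separately instead of linearity. *)
Lemma stein_inverse (R : realType) (n : nat) (L : 'M[R]_n) (t g : R) :
  0 <= t -> 0 <= g -> g < 1 -> (forall k, spnorm (L ^+ k) <= t * g ^+ k) ->
  exists T : 'M[R]_n -> 'M[R]_n,
    [/\ forall Y, stein L (T Y) = Y,
        forall Y, Y^T = Y -> (T Y)^T = T Y,
        forall Y, spnorm (T Y) <= t ^+ 2 / (1 - g ^+ 2) * spnorm Y &
        forall Y Z, spnorm (T Y - T Z) <= t ^+ 2 / (1 - g ^+ 2) * spnorm (Y - Z)].
Proof.
move=> t0 g0 g1 Lk.
have inj X : stein L X = 0 -> X = 0.
  move=> X0; apply: spnorm_le0; apply: (le_trans (spnorm_stein X t0 g0 g1 Lk)).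
  by rewrite X0 spnorm0 mulr0.
have lin : linear (stein L).
  move=> a X Y; rewrite /stein mulmxDr mulmxDl -scalemxAr -scalemxAl.
  by rewrite opprD addrACA -scalerBr.
pose f : {linear 'M[R]_n -> 'M[R]_n} :=
  HB.pack (stein L) (GRing.isLinear.Build R _ _ _ (stein L) lin).
have [T fK] := choice (linear_mx_surj (f := f) inj).
have TK Y : stein L (T Y) = Y := fK Y.
exists T; split=> [//|Y sY|Y|Y Z].
  apply/eqP; rewrite -subr_eq0; apply/eqP/inj; rewrite steinB TK.
  suff -> : stein L (T Y)^T = (stein L (T Y))^T by rewrite TK sY subrr.
  by rewrite /stein linearB /= !trmx_mul trmxK mulmxA.
  by apply: (le_trans (spnorm_stein _ t0 g0 g1 Lk)); rewrite TK.
by apply: (le_trans (spnorm_stein _ t0 g0 g1 Lk)); rewrite steinB !TK.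
Qed.

(** * Fixed points of contractions on a ball of symmetric matrices *)

(** Banach's theorem: the iterates from 0 stay in the ball, their limit is built entry by entry from
    suprema, and symmetry and the norm bound pass to the limit. *)
Lemma contraction_fixpoint (R : realType) (n : nat) (f : 'M[R]_n -> 'M[R]_n) (nu : R) :
  0 <= nu ->
  (forall X, X^T = X -> spnorm X <= nu -> (f X)^T = f X /\ spnorm (f X) <= nu) ->
  (forall X Y, X^T = X -> spnorm X <= nu -> Y^T = Y -> spnorm Y <= nu ->
     spnorm (f X - f Y) <= 2^-1 * spnorm (X - Y)) ->
  exists X, [/\ X^T = X, spnorm X <= nu & f X = X].
Proof.
move=> nu0 fD fC; pose x k := iter k f 0; pose q : R := 2^-1.
have q0 : 0 <= q by rewrite invr_ge0.
have q1 : q < 1 by rewrite invf_lt1 // ltr1n.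
have xD k : (x k)^T = x k /\ spnorm (x k) <= nu.
  elim: k => [|k [? ?]]; first by rewrite trmx0 spnorm0.
  exact: fD.
have xS k : (x k)^T = x k by case: (xD k).
have xN k : spnorm (x k) <= nu by case: (xD k).
(* The difference arises by applying [f] [k] times to [x j] and [x 0 = 0], which are at distance at
   most [nu]; hence no geometric sum appears. *)
have x_cauchy k j : spnorm (x (k + j)%N - x k) <= nu * q ^+ k.
  elim: k => [|k IH]; first by rewrite subr0 expr0 mulr1.
  by rewrite (le_trans (fC _ _ _ _ _ _)) // exprS mulrCA ler_wpM2l.
(* Every lower end lies below every upper end, so the supremum of the lower ends lies in all the
   intervals. *)
have x_entry k m i j : x m i j - nu * q ^+ m <= x k i j + nu * q ^+ k.
  wlog: k m / (k <= m)%N => [wl|].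
    have [|/ltnW] := leqP k m; first exact: wl.
    move/subnKC => <-; set l := (k - m)%N.
    have := le_trans (entry_le_spnorm _ i j) (x_cauchy m l); rewrite !mxE ler_norml.
    have : 0 <= nu * q ^+ (m + l) by rewrite mulr_ge0 ?exprn_ge0.
    lra.
  move/subnKC => <-; set l := (m - k)%N.
  have := le_trans (entry_le_spnorm _ i j) (x_cauchy k l); rewrite !mxE ler_norml.
  have : 0 <= nu * q ^+ (k + l) by rewrite mulr_ge0 ?exprn_ge0.
  lra.
pose X : 'M[R]_n := \matrix_(i, j) sup (range (fun k => x k i j - nu * q ^+ k)).
have X_entry k i j : `|X i j - x k i j| <= nu * q ^+ k.
  rewrite mxE ler_norml; apply/andP; split.
    rewrite lerBrDl; apply: ub_le_sup; last by exists k.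
    by exists (x k i j + nu * q ^+ k) => _ [m _ <-].
  rewrite lerBlDl; apply: ge_sup; first by exists (x k i j - nu * q ^+ k), k.
  by move=> _ [m _ <-].
(* The double sum counts the entries. *)
pose D : R := (\sum_(i < n) \sum_(j < n) 1) * nu.
have X_lim k : spnorm (X - x k) <= D * q ^+ k.
  apply: (le_trans (spnorm_le_entry _)).
  rewrite /D -mulrA mulr_suml ler_sum // => i _; rewrite mulr_suml ler_sum // => j _.
  by rewrite mul1r; have := X_entry k i j; rewrite !mxE.
have XS : X^T = X.
  apply/matrixP => i j; rewrite !mxE.
  have -> // : (fun k => x k j i - nu * q ^+ k) = (fun k => x k i j - nu * q ^+ k).
  by apply/funext => k; rewrite -{1}(xS k) mxE.
have XN : spnorm X <= nu.
  rewrite -subr_le0; apply: (@geometric_le0 _ q D) => // k.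
  by rewrite lerBlDr -[X in spnorm X](subrK (x k)) spnorm_leD.
exists X; split=> //; apply/eqP; rewrite -subr_eq0; apply/eqP/spnorm_le0.
apply: (@geometric_le0 _ q (2 * D)) => // k.
have D0 : 0 <= D * q ^+ k := le_trans (spnorm_ge0 _) (X_lim k).
have -> : f X - X = (f X - f (x k)) - (X - x k.+1) by rewrite opprB addrA subrK.
have h1 : spnorm (f X - f (x k)) <= 2^-1 * (D * q ^+ k).
  by rewrite (le_trans (fC _ _ _ _ _ _)) // ler_wpM2l.
have := spnorm_leB h1 (X_lim k.+1); rewrite exprSr mulrA.
by move/le_trans; apply; move: D0; rewrite /q; lra.
Qed.

(** * Perturbation bounds for the Riccati map *)

Lemma spnorm_gramB (R : realType) (n d : nat) (B Bh : 'M[R]_(n, d))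
    (Rc : 'M[R]_d) (b r e : R) :
  spnorm B <= b -> spnorm Bh <= b -> spnorm (invmx Rc) <= r ->
  spnorm (Bh - B) <= e ->
  spnorm (gram Bh Rc - gram B Rc) <= 2 * b * r * e.
Proof.
move=> hb hbh hr he; rewrite /gram.
have -> : Bh *m invmx Rc *m Bh^T - B *m invmx Rc *m B^T =
    (Bh - B) *m invmx Rc *m Bh^T + B *m invmx Rc *m (Bh - B)^T.
  have -> : (Bh - B)^T = Bh^T - B^T by exact: linearB.
  by rewrite !(mulmxBr, mulmxBl) !addrA !subrK.
have hbt : spnorm Bh^T <= b by rewrite spnorm_tr.
have het : spnorm (Bh - B)^T <= e by rewrite spnorm_tr.
have := spnorm_leD (spnorm_leM (spnorm_leM he hr) hbt)
  (spnorm_leM (spnorm_leM hb hr) het).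
by move/le_trans; apply; lra.
Qed.

Definition ricc {R : realType} {n : nat} (A S N : 'M[R]_n) : 'M[R]_n :=
  A^T *m (N *m resolvent S N) *m A.

Lemma trmx_ricc (R : realType) (n : nat) (A S N : 'M[R]_n) :
  psdmx S -> psdmx N -> (ricc A S N)^T = ricc A S N.
Proof.
move=> hS hN; rewrite /ricc !trmx_mul trmxK trmx_resolvent // (proj1 hN).
by rewrite -resolvent_push // mulmxA.
Qed.

(** The data change one factor at a time. With [G = N (1 + S N)^-1], replacing [S] by [Sh] changes
    [G] by [Gh (S - Sh) G], and both factors have norm at most [|N|]. *)
Lemma spnorm_riccB (R : realType) (n : nat) (A Ah S Sh N : 'M[R]_n) (a p e delta : R) :
  psdmx S -> psdmx Sh -> psdmx N ->
  spnorm A <= a -> spnorm Ah <= a -> spnorm (Ah - A) <= e ->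
  spnorm (Sh - S) <= delta -> spnorm N <= p ->
  spnorm (ricc Ah Sh N - ricc A S N) <= 2 * a * p * e + a ^+ 2 * p ^+ 2 * delta.
Proof.
move=> hS hSh hN ha hah he hd hp; rewrite /ricc.
have gp := le_trans (spnorm_mul_resolvent hS hN) hp.
have ghp := le_trans (spnorm_mul_resolvent hSh hN) hp.
have gB : N *m resolvent Sh N - N *m resolvent S N =
    (N *m resolvent Sh N) *m (S - Sh) *m (N *m resolvent S N).
  by rewrite -mulmxBr resolventB // -mulmxBl !mulmxA.
move: (N *m resolvent Sh N) (N *m resolvent S N) gp ghp gB => Gh G gp ghp gB.
have -> : Ah^T *m Gh *m Ah - A^T *m G *m A =
    (Ah - A)^T *m Gh *m Ah + A^T *m Gh *m (Ah - A) + A^T *m (Gh - G) *m A.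
  have -> : (Ah - A)^T = Ah^T - A^T by exact: linearB.
  by rewrite !(mulmxBr, mulmxBl) !addrA !subrK.
have hat : spnorm A^T <= a by rewrite spnorm_tr.
have het : spnorm (Ah - A)^T <= e by rewrite spnorm_tr.
have hd' : spnorm (S - Sh) <= delta by rewrite -opprB spnormN.
have hG : spnorm (Gh - G) <= p * delta * p.
  by rewrite gB; apply: spnorm_leM => //; apply: spnorm_leM.
have := spnorm_leD (spnorm_leD (spnorm_leM (spnorm_leM het ghp) hah)
  (spnorm_leM (spnorm_leM hat ghp) he)) (spnorm_leM (spnorm_leM hat hG) ha).
by move/le_trans; apply; lra.
Qed.

(** For either data set the difference of the Riccati maps at [N1] and [N2] is [F1^T (N1 - N2) F2]
    with [F = (1 + S N)^-1 A]. Coercivity bounds each [F] by [2 p a], and the factors of the two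
    data sets differ by a term of first order in [e] and [delta], so the Lipschitz constant is
    small. *)
Lemma spnorm_ricc_lipschitz (R : realType) (n : nat) (A Ah S Sh N1 N2 : 'M[R]_n)
    (a p e delta : R) :
  psdmx S -> psdmx Sh -> psdmx N1 -> psdmx N2 ->
  (forall x, dot x x <= 2 * dot x (N1 *m x)) ->
  (forall x, dot x x <= 2 * dot x (N2 *m x)) ->
  spnorm A <= a -> spnorm Ah <= a -> spnorm (Ah - A) <= e ->
  spnorm (Sh - S) <= delta -> spnorm N1 <= p -> spnorm N2 <= p ->
  spnorm ((ricc Ah Sh N1 - ricc A S N1) - (ricc Ah Sh N2 - ricc A S N2))
  <= 4 * a * p * (2 * p ^+ 2 * delta * a + 2 * p * e) * spnorm (N1 - N2).
Proof.
move=> hS hSh h1 h2 c1 c2 ha hah he hd hp1 hp2.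
have hd' : spnorm (S - Sh) <= delta by rewrite -opprB spnormN.
have two (x y : R) : x <= y -> 2 * x <= 2 * y by move=> ?; rewrite ler_wpM2l.
have factor A' S' : psdmx S' -> ricc A' S' N1 - ricc A' S' N2 =
    (resolvent S' N1 *m A')^T *m (N1 - N2) *m (resolvent S' N2 *m A').
  move=> hS'; rewrite /ricc -mulmxBl -mulmxBr mul_resolventB // trmx_mul.
  by rewrite trmx_resolvent // !mulmxA.
have bound (A' S' N : 'M[R]_n) : psdmx S' -> psdmx N -> (forall x, dot x x <= 2 * dot x (N *m x)) ->
    spnorm A' <= a -> spnorm N <= p -> spnorm (resolvent S' N *m A') <= 2 * p * a.
  move=> ? ? ? ? hp; apply: spnorm_leM => //.
  by apply: (le_trans (spnorm_resolvent _ _ _)) => //; exact: two.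
have diff N : psdmx N -> (forall x, dot x x <= 2 * dot x (N *m x)) -> spnorm N <= p ->
    spnorm (resolvent Sh N *m Ah - resolvent S N *m A)
    <= 2 * p ^+ 2 * delta * a + 2 * p * e.
  move=> hN cN hp.
  have -> : resolvent Sh N *m Ah - resolvent S N *m A =
      resolvent Sh N *m (S - Sh) *m (N *m resolvent S N) *m Ah
      + resolvent S N *m (Ah - A).
    have -> : resolvent Sh N *m (S - Sh) *m (N *m resolvent S N)
        = resolvent Sh N - resolvent S N.
      by rewrite resolventB // -mulmxBl !mulmxA.
    by rewrite mulmxBr mulmxBl addrA subrK.
  have r1 := le_trans (spnorm_resolvent hS hN cN) (two _ _ hp).
  have r2 := le_trans (spnorm_resolvent hSh hN cN) (two _ _ hp).
  have g := le_trans (spnorm_mul_resolvent hS hN) hp.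
  have := spnorm_leD (spnorm_leM (spnorm_leM (spnorm_leM r2 hd') g) hah)
    (spnorm_leM r1 he).
  by move/le_trans; apply; lra.
rewrite opprD addrACA -opprD !factor //.
have := bound Ah Sh N2 hSh h2 c2 hah hp2; have := bound A S N1 hS h1 c1 ha hp1.
have := diff N1 h1 c1 hp1; have := diff N2 h2 c2 hp2.
move: (resolvent Sh N1 *m Ah) (resolvent Sh N2 *m Ah) => F1h F2h.
move: (resolvent S N1 *m A) (resolvent S N2 *m A) => F1 F2 d2 d1 b1 b2.
have -> : F1h^T *m (N1 - N2) *m F2h - F1^T *m (N1 - N2) *m F2 =
    (F1h - F1)^T *m (N1 - N2) *m F2h + F1^T *m (N1 - N2) *m (F2h - F2).
  have -> : (F1h - F1)^T = F1h^T - F1^T by exact: linearB.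
  by move: (N1 - N2) => N; rewrite !(mulmxBr, mulmxBl) !addrA !subrK.
have d1t : spnorm (F1h - F1)^T <= 2 * p ^+ 2 * delta * a + 2 * p * e.
  by rewrite spnorm_tr.
have b1t : spnorm F1^T <= 2 * p * a by rewrite spnorm_tr.
have := spnorm_leD (spnorm_leM (spnorm_leM d1t (lexx (spnorm (N1 - N2)))) b2)
    (spnorm_leM (spnorm_leM b1t (lexx (spnorm (N1 - N2)))) d2).
by move/le_trans; apply; lra.
Qed.

Lemma spnorm_quadratic_remainder (R : realType) (n : nat) (S P X L : 'M[R]_n) (s nu l : R) :
  psdmx S -> psdmx (P + X) -> spnorm S <= s -> spnorm X <= nu -> spnorm L <= l ->
  spnorm (L^T *m (X *m (resolvent S (P + X) *m S) *m X) *m L)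
  <= l ^+ 2 * s * nu ^+ 2.
Proof.
move=> hS hN hs hX hl; have lt : spnorm L^T <= l by rewrite spnorm_tr.
have w := le_trans (spnorm_resolvent_mul hS hN) hs.
have := spnorm_leM (spnorm_leM lt (spnorm_leM (spnorm_leM hX w) hX)) hl.
by move/le_trans; apply; lra.
Qed.

(** The three factors depending on [X] are exchanged one at a time; the two outer ones yield
    [2 s nu], the middle one [(s nu)^2]. *)
Lemma spnorm_quadratic_remainderB (R : realType) (n : nat) (S P X Y L : 'M[R]_n) (s nu l : R) :
  psdmx S -> psdmx (P + X) -> psdmx (P + Y) ->
  spnorm S <= s -> spnorm X <= nu -> spnorm Y <= nu -> spnorm L <= l ->
  spnorm (L^T *m (X *m (resolvent S (P + X) *m S) *m X) *m L
          - L^T *m (Y *m (resolvent S (P + Y) *m S) *m Y) *m L)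
  <= l ^+ 2 * (2 * s * nu + (s * nu) ^+ 2) * spnorm (X - Y).
Proof.
move=> hS hX hY hs nX nY hl; have lt : spnorm L^T <= l by rewrite spnorm_tr.
have wX := le_trans (spnorm_resolvent_mul hS hX) hs.
have wY := le_trans (spnorm_resolvent_mul hS hY) hs.
have wB : spnorm (resolvent S (P + X) *m S - resolvent S (P + Y) *m S)
    <= s * spnorm (X - Y) * s.
  rewrite resolvent_mulB //; apply: spnorm_leM => //; apply: spnorm_leM => //.
  by rewrite opprD addrACA subrr add0r -opprB spnormN.
rewrite -mulmxBl -mulmxBr.
move: (resolvent S (P + X) *m S) (resolvent S (P + Y) *m S) wX wY wB => W V wX wY wB.
have -> : X *m W *m X - Y *m V *m Y =
    (X - Y) *m W *m X + Y *m (W - V) *m X + Y *m V *m (X - Y).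
  by rewrite !(mulmxBl, mulmxBr) !addrA !subrK.
have D := lexx (spnorm (X - Y)).
have := spnorm_leM (spnorm_leM lt (spnorm_leD (spnorm_leD
   (spnorm_leM (spnorm_leM D wX) nX) (spnorm_leM (spnorm_leM nY wB) nX))
   (spnorm_leM (spnorm_leM nY wY) D))) hl.
by move/le_trans; apply; lra.
Qed.

(* X |-> X - L^T X L is inverted by T, and the perturbed equation for P + X
   becomes the fixed point equation X = T (Y X); the part of Y that is linear
   in X cancels, leaving the perturbation D and the quadratic remainder H. *)
Lemma riccati_fixpoint (R : realType) (n : nat) (A Ah S Sh Q Qh P L : 'M[R]_n)
    (t g theta eps a p s delta l nu : R) :
  psdmx S -> psdmx Sh -> psdmx P -> Qh^T = Qh ->
  P = ricc A S P + Q -> L = resolvent S P *m A ->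
  (forall x, dot x x <= dot x (P *m x)) ->
  0 <= t -> 0 <= g -> g < 1 -> (forall k, spnorm (L ^+ k) <= t * g ^+ k) ->
  theta = t ^+ 2 / (1 - g ^+ 2) -> 0 <= nu -> nu <= 2^-1 ->
  spnorm A <= a -> spnorm Ah <= a -> spnorm (Ah - A) <= eps ->
  spnorm S <= s -> spnorm (Sh - S) <= delta -> spnorm (Qh - Q) <= eps ->
  spnorm L <= l -> spnorm P + nu <= p ->
  theta * (eps + (2 * a * p * eps + a ^+ 2 * p ^+ 2 * delta)
           + l ^+ 2 * s * nu ^+ 2) <= nu ->
  theta * (4 * a * p * (2 * p ^+ 2 * delta * a + 2 * p * eps)
           + l ^+ 2 * (2 * s * nu + (s * nu) ^+ 2)) <= 2^-1 ->
  exists X, [/\ psdmx (P + X), P + X = ricc Ah Sh (P + X) + Qh & spnorm X <= nu].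
Proof.
move=> hS hSh hP sQh PE LE cP t0 g0 g1 Lk thetaE nu0 nu2.
move=> nA nAh eA nS eS eQ nL nP k1 k2.
have th0 : 0 <= theta.
  by rewrite thetaE divr_ge0 ?sqr_ge0 // subr_ge0 ltW // expr_lt1.
have nN X : spnorm X <= nu -> spnorm (P + X) <= p.
  by move=> nX; rewrite (le_trans (spnorm_leD (lexx _) nX)).
(* [P >= 1] and [|X| <= 1/2] leave [P + X >= 1/2]. *)
have cN X : spnorm X <= nu -> forall x, dot x x <= 2 * dot x ((P + X) *m x).
  move=> nX x; rewrite mulmxDl dotDr.
  have : - dot x (X *m x) <= 2^-1 * dot x x.
    rewrite -mulN1r -dotZr scaleN1r -mulNmx (le_trans (dot_le _ _)) //.
    rewrite mulrC (le_trans (ler_wpM2r (l2norm_ge0 x) (spnormP _ _))) // spnormN.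
    rewrite -mulrA -expr2 sqr_l2norm ler_wpM2r ?dot_ge0 //.
    exact: le_trans nX nu2.
  by move: (cP x); clear; lra.
have psdN X : X^T = X -> spnorm X <= nu -> psdmx (P + X).
  move=> sX nX; split=> [|x]; first by rewrite linearD /= (proj1 hP) sX.
  by rewrite dot_quad; move: (cN X nX x) (dot_ge0 x); clear; lra.
have [T [TK Tsym Tnorm TnormB]] := stein_inverse t0 g0 g1 Lk.
rewrite -thetaE in Tnorm TnormB.
pose Y X := Qh + ricc Ah Sh (P + X) - P - L^T *m X *m L.
pose H X := L^T *m (X *m (resolvent S (P + X) *m S) *m X) *m L.
pose D X := ricc Ah Sh (P + X) - ricc A S (P + X).
have YE X : X^T = X -> spnorm X <= nu -> Y X = (Qh - Q) + D X - H X.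
  move=> sX nX; have hN := psdN X sX nX.
  have expand : ricc A S (P + X) - ricc A S P - L^T *m X *m L = - H X.
    have := mul_resolvent_expand hS hP hN.
    move/(congr1 (fun Z => A^T *m Z *m A)).
    rewrite mulmxN mulNmx !mulmxBr !mulmxBl /H /ricc => e.
    by rewrite LE trmx_mul trmx_resolvent // !mulmxA in e *; rewrite e.
  have -> : Q = P - ricc A S P.
    by apply/eqP; rewrite eq_sym subr_eq addrC -PE.
  rewrite -expand /Y /D; clear.
  move: (ricc A S P) (ricc A S _) (ricc Ah Sh _) (L^T *m X *m L) => u v w z.
  by apply/matrixP => i j; rewrite !mxE; lra.
have Ysym X : X^T = X -> spnorm X <= nu -> (Y X)^T = Y X.
  move=> sX nX; rewrite /Y.
  have trB (U V : 'M[R]_n) : (U - V)^T = U^T - V^T by exact: linearB.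
  rewrite !trB [(Qh + _)^T]linearD /= sQh trmx_ricc //; last exact: psdN.
  by rewrite (proj1 hP) !trmx_mul trmxK sX mulmxA.
have [X [sX nX fX]] : exists X, [/\ X^T = X, spnorm X <= nu & T (Y X) = X].
  apply: (contraction_fixpoint (f := fun X => T (Y X))) => // [X sX nX|X X' sX nX sX' nX'].
    split; first by apply: Tsym; apply: Ysym.
    rewrite (le_trans (Tnorm _)) // YE // (le_trans _ k1) //.
    have nD := spnorm_riccB hS hSh (psdN X sX nX) nA nAh eA eS (nN X nX).
    have nH := spnorm_quadratic_remainder hS (psdN X sX nX) nS nX nL.
    by rewrite ler_wpM2l //; exact: spnorm_leB (spnorm_leD eQ nD) nH.
  rewrite (le_trans (TnormB _ _)) // !YE //.
  have -> : Qh - Q + D X - H X - (Qh - Q + D X' - H X') = (D X - D X') - (H X - H X').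
    move: (D X) (D X') (H X) (H X') => u v w z.
    by apply/matrixP => i j; rewrite !mxE; clear; lra.
  have nD := spnorm_ricc_lipschitz hS hSh (psdN X sX nX) (psdN X' sX' nX')
    (cN X nX) (cN X' nX') nA nAh eA eS (nN X nX) (nN X' nX').
  have nH := spnorm_quadratic_remainderB hS (psdN X sX nX) (psdN X' sX' nX')
    nS nX nX' nL.
  have PX : P + X - (P + X') = X - X' by rewrite opprD addrACA subrr add0r.
  rewrite PX in nD.
  rewrite (le_trans (ler_wpM2l th0 (spnorm_leB nD nH))) //.
  by rewrite -mulrDl mulrA ler_wpM2r // spnorm_ge0.
exists X; split=> //; first exact: psdN.
(* At the fixed point [stein L X = Y X]; cancelling [L^T X L] on both sides leaves the perturbed
   Riccati equation. *)
have := TK (Y X); rewrite fX /stein /Y => /addIr {1}->.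
by rewrite addrC subrK addrC.
Qed.

(** * Choice of the radius and of the numerical constants *)

Lemma ler_of_mul_ge1 (R : realType) (x y k : R) :
  0 <= x -> 1 <= k -> x * k <= y -> x <= y.
Proof. by move=> x0 k1; apply: le_trans; rewrite ler_peMr. Qed.

(** Checks the scalar conditions of [riccati_fixpoint]. The margin 1 in [a], [p] and [b] absorbs the
    perturbation, as [eps <= 1] and [nu <= 1/2], so the same letters bound [Ah], [Ps + X] and [Bh].
    The two smallness conditions match the two entries of the minimum in the theorem. *)
Lemma dare_perturbation (R : realType) (n d : nat) (As Ah : 'M[R]_n)
    (Bs Bh : 'M[R]_(n, d)) (Qs Qh : 'M[R]_n) (Rc : 'M[R]_d) (Ps : 'M[R]_n)
    (t g theta eps a p b r l : R) :
  psdmx Qh -> pdmx Rc -> psd_dare_sol As Bs Qs Rc Ps ->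
  (forall x, dot x x <= dot x (Ps *m x)) ->
  0 <= t -> 0 <= g -> g < 1 ->
  (forall k, spnorm (closed_loop As Bs Rc Ps ^+ k) <= t * g ^+ k) ->
  theta = t ^+ 2 / (1 - g ^+ 2) -> 1 <= theta ->
  1 <= a -> 1 <= p -> 1 <= b -> 1 <= r -> 1 <= l -> 0 <= eps ->
  spnorm As <= a - 1 -> spnorm Ps <= p - 1 -> spnorm Bs <= b - 1 ->
  spnorm (invmx Rc) <= r -> spnorm (closed_loop As Bs Rc Ps) <= l ->
  spnorm (Ah - As) <= eps -> spnorm (Bh - Bs) <= eps -> spnorm (Qh - Qs) <= eps ->
  200 * (eps * (theta ^+ 2 * a ^+ 2 * p ^+ 2 * b ^+ 3 * r ^+ 2 * l ^+ 2)) <= 1 ->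
  200 * (eps * (theta ^+ 2 * a ^+ 2 * p ^+ 3 * b ^+ 3 * r ^+ 2)) <= 1 ->
  exists Ph, psd_dare_sol Ah Bh Qh Rc Ph /\
    spnorm (Ph - Ps) <= 10 * eps * theta * (a ^+ 2 * p ^+ 2 * b * r).
Proof.
move=> hQh hR [hP dP] cP t0 g0 g1.
rewrite closed_loop_gram // => Lk thetaE th1 a1 p1 b1 r1 l1 e0.
move=> nA nP nB nR nL eA eB eQ k1 k2.
have hS : psdmx (gram Bs Rc) by exact: gram_psd.
have hSh : psdmx (gram Bh Rc) by exact: gram_psd.
have ge1 := (@mulr_ege1 R, @exprn_ege1 R).
have ge0 := (@mulr_ge0 R, @exprn_ge0 R).
have a0 := le_trans ler01 a1; have p0 := le_trans ler01 p1.
have b0 := le_trans ler01 b1; have r0 := le_trans ler01 r1.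
have l0 := le_trans ler01 l1; have th0 := le_trans ler01 th1.
(* nu is twice the first order part of the bound on the fixed point map. *)
pose M := a ^+ 2 * p ^+ 2 * b * r; pose nu := 10 * eps * theta * M.
have M1 : 1 <= M by rewrite /M !ge1.
have M0 := le_trans ler01 M1.
have nu0 : 0 <= nu by rewrite /nu !ge0.
have e1 : eps <= 1.
  apply: (@ler_of_mul_ge1 _ _ _
    (theta ^+ 2 * a ^+ 2 * p ^+ 2 * b ^+ 3 * r ^+ 2 * l ^+ 2)) => //.
    by rewrite !ge1.
  by move: k1; clear; lra.
have nu2 : nu <= 2^-1.
  apply: (@ler_of_mul_ge1 _ _ _ (theta * b ^+ 2 * r * l ^+ 2)) => //.
    by rewrite !ge1.
  by rewrite /nu /M; move: k1; clear; lra.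
pose s := b ^+ 2 * r.
have s0 : 0 <= s by rewrite /s !ge0.
(* This is [k1] expanded: its 200 is 20 times the factor 10 of [nu]. *)
have snu : 20 * (theta * l ^+ 2 * (s * nu)) <= 1.
  by rewrite /nu /M /s; move: k1; clear; lra.
have snu1 : s * nu <= 1.
  apply: (@ler_of_mul_ge1 _ _ _ (theta * l ^+ 2)); rewrite ?ge1 ?ge0 //.
  by move: snu; clear; lra.
have k3 : 4 * (theta * (24 * p ^+ 3 * a ^+ 2 * b * r * eps)) <= 1.
  apply: (@ler_of_mul_ge1 _ _ _ (theta * b ^+ 2 * r)); rewrite ?ge1 ?ge0 //.
  by rewrite /nu /M; move: k2; clear; lra.
have near m k (U V : 'M[R]_(m, k)) x : spnorm U <= x - 1 -> spnorm (V - U) <= eps ->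
    spnorm V <= x.
  move=> hU hV; rewrite -[V](subrK U) (le_trans (spnorm_leD hV hU)) //.
  by move: e1; clear; lra.
have weak m k (U : 'M[R]_(m, k)) x : spnorm U <= x - 1 -> spnorm U <= x.
  by clear; lra.
have nS : spnorm (gram Bs Rc) <= s.
  have nBt : spnorm Bs^T <= b by rewrite spnorm_tr weak.
  have := spnorm_leM (spnorm_leM (weak _ _ _ _ nB) nR) nBt.
  by move/le_trans; apply; rewrite /s; clear; lra.
have eS := spnorm_gramB (weak _ _ _ _ nB) (near _ _ _ _ _ nB eB) nR eB.
have PE : Ps = ricc As (gram Bs Rc) Ps + Qs by rewrite {1}dP riccati_gram.
have [|||X [pX EX nX]] := riccati_fixpoint hS hSh hP (proj1 hQh) PE erefl cP
  t0 g0 g1 Lk thetaE nu0 nu2 (weak _ _ _ _ nA) (near _ _ _ _ _ nA eA) eA nS eS eQ nL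
  (p := p).
- by move: nP nu2; clear; lra.
(* The ball is mapped into itself: [1 + 2 a p + 2 M <= 5 M] makes the first order part at most
   [nu / 2], and by [snu] the quadratic part is at most [nu / 20]. *)
- have apM : a * p <= M.
    rewrite /M; have -> : a ^+ 2 * p ^+ 2 * b * r = a * p * (a * p * b * r) by ring.
    by rewrite ler_peMr ?ge1 ?ge0.
  have low : theta * (eps + (2 * a * p * eps + a ^+ 2 * p ^+ 2 * (2 * b * r * eps)))
      <= 2^-1 * nu.
    have : theta * eps * (1 + 2 * (a * p) + 2 * M) <= theta * eps * (5 * M).
      by rewrite ler_wpM2l ?ge0 //; move: apM M1; clear; lra.
    by rewrite /nu /M; clear; lra.
  have quad : theta * (l ^+ 2 * s * nu ^+ 2) <= 2^-1 * nu.
    have := ler_wpM2r nu0 snu; rewrite mul1r; move: nu0; clear; lra.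
  by move: low quad; clear; lra.
(* The contraction factor 1/2 splits into two quarters: [k3] bounds the perturbation part, and
   [s nu <= 1] bounds the quadratic part by 3/20. *)
- have apM : a * p ^+ 2 <= a ^+ 2 * p ^+ 3 * b * r.
    have -> : a ^+ 2 * p ^+ 3 * b * r = a * p ^+ 2 * (a * p * b * r) by ring.
    by rewrite ler_peMr ?ge1 ?ge0.
  have low : theta * (4 * a * p * (2 * p ^+ 2 * (2 * b * r * eps) * a + 2 * p * eps))
      <= 4^-1.
    have : theta * eps * (16 * (a ^+ 2 * p ^+ 3 * b * r) + 8 * (a * p ^+ 2))
        <= theta * eps * (24 * (a ^+ 2 * p ^+ 3 * b * r)).
      by rewrite ler_wpM2l ?ge0 //; move: apM; clear; lra.
    by move: k3; clear; lra.
  have quad : theta * (l ^+ 2 * (2 * s * nu + (s * nu) ^+ 2)) <= 4^-1.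
    have : theta * l ^+ 2 * (s * nu) * (s * nu) <= theta * l ^+ 2 * (s * nu).
      by rewrite ler_piMr ?ge0.
    by move: snu; clear; lra.
  by move: low quad; clear; lra.
exists (Ps + X); split; last by rewrite addrAC subrr add0r.
by split=> //; rewrite /dare_eq riccati_gram.
Qed.

(** * Degenerate values of [sigma_min], [spectral_radius] and [tau], and the final assembly *)

(** Excludes empty matrices, where the infimum is over the empty set and has the default value 0;
    [tau_ge1] needs this. *)
Lemma sigma_min_size_gt0 (R : realType) (n : nat) (M : 'M[R]_n) :
  0 < sigma_min M -> (0 < n)%N.
Proof.
case: n M => // M; rewrite /sigma_min.
have -> : [set a : R | eigenvalue (M^T *m M) a] = set0.
  apply/seteqP; split=> // a /= /eigenvalueP[v _].
  by rewrite [v]thinmx0 eqxx.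
by rewrite image_set0 inf0 ltxx.
Qed.

Lemma spectral_radius_ge0 (R : realType) (n : nat) (M : 'M[R]_n) :
  0 <= spectral_radius M.
Proof.
rewrite /spectral_radius; set E := (X in sup X).
have [[[x Ex] ubE]|/sup_out -> //] := pselect (has_sup E).
apply: (le_trans _ (ub_le_sup ubE Ex)).
by case: Ex => z _ <-; case: z => u v; exact: sqrtr_ge0.
Qed.

Lemma tau_ge1 (R : realType) (n : nat) (M : 'M[R]_n) (g : R) :
  (0 < n)%N -> (1 <= tau M g)%E.
Proof.
case: n M => // n M _; apply: ereal_sup_ubound; exists 0%N => //.
by rewrite !expr0 spnorm1 inver oner_eq0 invr1 mul1e.
Qed.

(** If [g^k = 0], the quotient is infinite unless the norm of [M^k] vanishes, so a finite [tau]
    gives the bound in this case too. *)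
Lemma tau_fin (R : realType) (n : nat) (M : 'M[R]_n) (g t : R) :
  0 <= g -> tau M g = t%:E -> forall k, spnorm (M ^+ k) <= t * g ^+ k.
Proof.
move=> g0 tE k.
have : ((spnorm (M ^+ k))%:E / (g ^+ k)%:E <= t%:E)%E.
  by rewrite -tE; apply: ereal_sup_ubound; exists k.
rewrite inver; case: eqVneq => [->|gk].
  rewrite mulr0; have [//|s0] := leP (spnorm (M ^+ k)) 0.
  by rewrite gt0_muley ?lte_fin.
by rewrite -EFinM lee_fin ler_pdivrMr // lt_def gk exprn_ge0.
Qed.

(** Here [m] is the minimum and [k] the reciprocal of one of its entries; the lemma is applied once
    to each entry. *)
Lemma clear_denominators (R : realType) (eps w t K m k : R) :
  0 < w -> 0 < t -> 0 < K -> 0 < k -> m <= k^-1 ->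
  eps <= 200^-1 * (w ^+ 2 / t ^+ 4) * (K^-1 * m) ->
  200 * (eps * ((t ^+ 2 / w) ^+ 2 * K * k)) <= 1.
Proof.
move=> w0 t0 K0 k0 mk he.
have X0 : 0 < (t ^+ 2 / w) ^+ 2 * K * k.
  by rewrite mulr_gt0 // mulr_gt0 // exprn_gt0 // divr_gt0 // exprn_gt0.
have {}he : eps <= 200^-1 * (w ^+ 2 / t ^+ 4) * (K^-1 * k^-1).
  apply: (le_trans he); rewrite ler_pM2l; last by rewrite !mulr_gt0 ?invr_gt0 ?exprn_gt0.
  by rewrite ler_pM2l ?invr_gt0.
have := ler_wpM2r (ltW X0) he.
have -> : 200^-1 * (w ^+ 2 / t ^+ 4) * (K^-1 * k^-1) * ((t ^+ 2 / w) ^+ 2 * K * k) = 200^-1.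
  by field; rewrite !gt_eqF.
lra.
Qed.

Unset Implicit Arguments.

Theorem proposition2 (R : realType) :
  exists c C : R, 0 < c /\ 0 < C /\
  forall (n d : nat)
    (As Ah : 'M[R]_n) (Bs Bh : 'M[R]_(n, d)) (Qs Qh : 'M[R]_n)
    (Rc : 'M[R]_d) (Ps Qs_sqrt : 'M[R]_n) (gamma eps : R),
  let Ls := closed_loop As Bs Rc Ps in
  psdmx Qs -> psdmx Qh ->
  pdmx Rc ->
  psd_dare_sol As Bs Qs Rc Ps ->
  spectral_radius Ls <= gamma -> gamma < 1 ->
  spnorm (Ah - As) <= eps ->
  spnorm (Bh - Bs) <= eps ->
  spnorm (Qh - Qs) <= eps ->
  stabilizable As Bs ->
  is_psd_sqrt Qs Qs_sqrt -> observable Qs_sqrt As ->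
  1 <= sigma_min Ps ->
  (eps%:E <= c%:E
     * (((1 - gamma ^+ 2) ^+ 2)%:E / (tau Ls gamma) ^+ 4)
     * (spnormp As ^- 2 * spnormp Ps ^- 2 * spnormp Bs ^- 3
        * spnormp (invmx Rc) ^- 2
        * Num.min (spnormp Ls ^- 2) (spnormp Ps)^-1)%:E)%E ->
  let bound := (C%:E * eps%:E
     * ((tau Ls gamma) ^+ 2 / (1 - gamma ^+ 2)%:E)
     * (spnormp As ^+ 2 * spnormp Ps ^+ 2 * spnormp Bs
        * spnormp (invmx Rc))%:E)%E in
  (exists Ph : 'M[R]_n, psd_dare_sol Ah Bh Qh Rc Ph /\
     ((spnorm (Ph - Ps))%:E <= bound)%E) /\
  (forall Ph : 'M[R]_n, unique (psd_dare_sol Ah Bh Qh Rc) Ph ->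
     ((spnorm (Ph - Ps))%:E <= bound)%E).
Proof.
(* The 200 and the 10 are those of [dare_perturbation]. *)
exists 200^-1, 10; split; first by rewrite invr_gt0.
split=> // n d As Ah Bs Bh Qs Qh Rc Ps Qs_sqrt gamma eps Ls _ hQh hR hP.
move=> rho_gamma gamma1 eA eB eQ _ _ _ sP eps_le bound.
have n0 : (0 < n)%N by apply: (@sigma_min_size_gt0 _ _ Ps); exact: lt_le_trans sP.
have gamma0 : 0 <= gamma := le_trans (spectral_radius_ge0 _) rho_gamma.
have eps0 : 0 <= eps := le_trans (spnorm_ge0 _) eA.
(* A unique solution coincides with the one constructed, so existence with the bound yields both
   claims. *)
suff [Ph [hPh Ph_le]] : exists Ph : 'M[R]_n, psd_dare_sol Ah Bh Qh Rc Ph /\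
     ((spnorm (Ph - Ps))%:E <= bound)%E.
  split; first by exists Ph.
  by move=> P' [_ /(_ Ph hPh) ->].
move: eps_le @bound; have := tau_ge1 Ls gamma n0.
(* The value [-oo] contradicts [1 <= tau]. *)
case E : (tau Ls gamma) => [t||] t1 eps_le //.
- rewrite lee_fin in t1; have t0 : 0 < t := lt_le_trans ltr01 t1.
  have w0 : 0 < 1 - gamma ^+ 2 by rewrite subr_gt0 expr_lt1.
  have cP x : dot x x <= dot x (Ps *m x).
    by rewrite -[dot x x]mul1r; apply: sigma_min_rayleigh => //; case: hP.
  have ge1 m k (M : 'M[R]_(m, k)) : 1 <= spnormp M by rewrite lerDr spnorm_ge0.
  have gt0 m k (M : 'M[R]_(m, k)) : 0 < spnormp M := lt_le_trans ltr01 (ge1 _ _ M).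
  have le_p m k (M : 'M[R]_(m, k)) : spnorm M <= spnormp M by rewrite lerDl.
  have le_p1 m k (M : 'M[R]_(m, k)) : spnorm M <= spnormp M - 1 by rewrite addrK.
  have th1 : 1 <= t ^+ 2 / (1 - gamma ^+ 2).
    rewrite ler_pdivlMr // mul1r (le_trans _ (exprn_ege1 2 t1)) //.
    by rewrite gerBl sqr_ge0.
  move: eps_le; rewrite -EFin_expe inver gt_eqF ?exprn_gt0 // -!EFinM lee_fin => eps_le.
  have K0 : 0 < spnormp As ^+ 2 * spnormp Ps ^+ 2 * spnormp Bs ^+ 3
    * spnormp (invmx Rc) ^+ 2 by rewrite !mulr_gt0 ?exprn_gt0.
  rewrite -!invfM in eps_le.
  have k1 := clear_denominators w0 t0 K0 (exprn_gt0 2 (gt0 _ _ Ls)) _ eps_le.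
  have k2 := clear_denominators w0 t0 K0 (gt0 _ _ Ps) _ eps_le.
  rewrite ge_min lexx in k1; rewrite ge_min lexx orbT in k2.
  have [||Ph [hPh Ph_le]] := dare_perturbation hQh hR hP cP (ltW t0) gamma0 gamma1
    (tau_fin gamma0 E) erefl th1 (ge1 _ _ As) (ge1 _ _ Ps) (ge1 _ _ Bs)
    (ge1 _ _ (invmx Rc)) (ge1 _ _ Ls) eps0 (le_p1 _ _ _) (le_p1 _ _ _) (le_p1 _ _ _)
    (le_p _ _ _) (le_p _ _ _) eA eB eQ.
  + by move: (k1 isT); rewrite !mulrA.
  + by apply: le_trans (k2 isT); rewrite le_eqVlt; apply/orP; left; apply/eqP; ring.
  exists Ph; split=> //.
  by rewrite -EFin_expe inver gt_eqF // -!EFinM lee_fin.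
(* tau = +oo forces eps = 0, so the two problems coincide. *)
- have eps_eq0 : eps <= 0.
    move: eps_le; rewrite (_ : (+oo ^+ 4 = +oo)%E) // invey mule0 mule0 mul0e.
    by rewrite lee_fin.
  have same m k (U V : 'M[R]_(m, k)) : spnorm (U - V) <= eps -> U = V.
    by move=> h; apply/eqP; rewrite -subr_eq0; apply/eqP/spnorm_le0; lra.
  exists Ps; rewrite (same _ _ _ _ eA) (same _ _ _ _ eB) (same _ _ _ _ eQ).
  split=> //; rewrite subrr spnorm0.
  have -> : eps = 0 by apply/le_anti; rewrite eps_eq0.
  by rewrite mule0 !mul0e.
Qed.
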